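(* Let $N$ be a finitely generated torsion-free nilpotent group of nilpotency class $c$, let $H\le N$ have finite index, and let $\phi:H\to N$ be a homomorphism. Let $\phi_i:H_iN_{i+1}/N_{i+1}\to N_i/N_{i+1}$ ($1\le i\le c$) be the induced morphisms. Then \[R(\phi)=\prod_{i=1}^cR(\phi_i),\] where a product containing a factor $\infty$ is $\infty$.
   Context: Lower central series: $\gamma_1(K)=K$, $\gamma_{i+1}(K)=[K,\gamma_i(K)]$. Isolator: $\sqrt[K]{L}=\{x\in K:\exists m>0,\ x^m\in L\}$. $N_i=\sqrt[N]{\gamma_i(N)}$ and $H_i=\sqrt[H]{\gamma_i(H)}$, with $N_{c+1}=1$. $\phi_i$ is defined by $hN_{i+1}\mapsto\phi(h)N_{i+1}$ for $h\in H_i$; it is a well-defined homomorphism from the finite-index subgroup $H_iN_{i+1}/N_{i+1}$ of the abelian group $N_i/N_{i+1}$ into $N_i/N_{i+1}$. For a group $K$, a finite-index subgroup $L$ and a homomorphism $\phi:L\to K$, $R(\phi)$ is the number (possibly $\infty$) of classes of the relation $\alpha\sim_\phi\beta\iff\exists\gamma\in L:\ \alpha=\gamma\beta\phi(\gamma^{-1})$ on $K$. *)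

(* Defs.v *)
From Stdlib Require Import Arith List ClassicalEpsilon.
Import ListNotations.

Record Group := Grp {
  gT :> Type;
  gmul : gT -> gT -> gT;
  ginv : gT -> gT;
  gone : gT;
  gmulA : forall x y z, gmul x (gmul y z) = gmul (gmul x y) z;
  gmul1 : forall x, gmul gone x = x;
  gmulV : forall x, gmul (ginv x) x = gone }.

Arguments gmul {g}.
Arguments ginv {g}.
Arguments gone {g}.

Section GroupDefs.
Variable G : Group.

Fixpoint gpow (x : G) (n : nat) : G :=
  match n with 0 => gone | S m => gmul x (gpow x m) end.

Definition gcomm (x y : G) : G := gmul (gmul (ginv x) (ginv y)) (gmul x y).

Definition subgroup (P : G -> Prop) : Prop :=
  P gone /\ (forall x y, P x -> P y -> P (gmul x y)) /\ (forall x, P x -> P (ginv x)).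

Definition gen (S : G -> Prop) : G -> Prop :=
  fun x => forall P, subgroup P -> (forall y, S y -> P y) -> P x.

(* lcs K n = gamma_{n+1}(K) *)
Fixpoint lcs (K : G -> Prop) (n : nat) : G -> Prop :=
  match n with
  | 0 => K
  | S m => gen (fun z => exists x y, K x /\ lcs K m y /\ z = gcomm x y)
  end.

(* lower central series, 1-indexed: gamma K 1 = K, gamma K (i+1) = [K, gamma K i] *)
Definition gamma (K : G -> Prop) (i : nat) : G -> Prop := lcs K (pred i).

Definition isolator (K L : G -> Prop) : G -> Prop :=
  fun x => K x /\ exists m, 0 < m /\ L (gpow x m).

Definition setT : G -> Prop := fun _ => True.

Definition Niso (i : nat) : G -> Prop := isolator setT (gamma setT i).
Definition Hiso (H : G -> Prop) (i : nat) : G -> Prop := isolator H (gamma H i).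

Definition finitely_generated : Prop :=
  exists l : list G, forall x, gen (fun y => In y l) x.

Definition torsion_free : Prop :=
  forall (x : G) m, 0 < m -> gpow x m = gone -> x = gone.

Definition trivial_set (P : G -> Prop) : Prop := forall x, P x -> x = gone.

Definition nilpotent_class (c : nat) : Prop :=
  trivial_set (gamma setT (S c)) /\
  forall c', c' < c -> ~ trivial_set (gamma setT (S c')).

Definition finite_index (H : G -> Prop) : Prop :=
  exists l : list G, forall x, exists y h, In y l /\ H h /\ x = gmul y h.

(* phi : H -> N homomorphism (values outside H irrelevant) *)
Definition is_hom_on (H : G -> Prop) (phi : G -> G) : Prop :=
  forall x y, H x -> H y -> phi (gmul x y) = gmul (phi x) (phi y).

(* ---------- counting classes (None = infinitely many) ---------- *)
Definition has_n_classes (D : G -> Prop) (E : G -> G -> Prop) (n : nat) : Prop :=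
  exists l : list G, length l = n /\ (forall x, In x l -> D x) /\
    (forall i j x y, nth_error l i = Some x -> nth_error l j = Some y -> E x y -> i = j) /\
    (forall a, D a -> exists x, In x l /\ E a x).

Definition num_classes (D : G -> Prop) (E : G -> G -> Prop) : option nat :=
  match excluded_middle_informative (exists n, has_n_classes D E n) with
  | left h => Some (proj1_sig (constructive_indefinite_description _ h))
  | right _ => None
  end.

Definition twisted_rel (L : G -> Prop) (phi : G -> G) (a b : G) : Prop :=
  exists g, L g /\ a = gmul (gmul g b) (phi (ginv g)).

Definition reidemeister (L : G -> Prop) (phi : G -> G) : option nat :=
  num_classes setT (twisted_rel L phi).

(* The same relation for the induced map phi_i on the quotient N_i/N_{i+1},
   written on coset representatives: for alpha, beta in N_i,
   alpha N_{i+1} ~ beta N_{i+1} iff exists h in H_i with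
   alpha N_{i+1} = h beta phi(h^-1) N_{i+1}
   (elements of H_i N_{i+1}/N_{i+1} are the cosets h N_{i+1}, h in H_i, and
   phi_i(h N_{i+1}) = phi(h) N_{i+1}). *)
Definition twisted_rel_mod (M L : G -> Prop) (phi : G -> G) (a b : G) : Prop :=
  exists g, L g /\ M (gmul (ginv (gmul (gmul g b) (phi (ginv g)))) a).

Definition reidemeister_induced (H : G -> Prop) (phi : G -> G) (i : nat) : option nat :=
  num_classes (Niso i) (twisted_rel_mod (Niso (S i)) (Hiso H i) phi).

End GroupDefs.

Definition omul (a b : option nat) : option nat :=
  match a, b with Some x, Some y => Some (x * y) | _, _ => None end.

Fixpoint oprod (f : nat -> option nat) (c : nat) : option nat :=
  match c with 0 => Some 1 | S k => omul (oprod f k) (f (S k)) end.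

(* Main.v *)
Require Import Defs.
From Stdlib Require Import Arith List ClassicalEpsilon.
From Stdlib Require Import Lia FinFun RelationClasses FunctionalExtensionality PropExtensionality.

(** For [0 <= k <= c] let [R_k] be the number of classes of [N] under
    [a = h b phi(h)^-1] modulo [N_{k+1}]; then [R_0 = 1] and [R_c = R(phi)], and it is
    enough that [R_{k+1} = R_k R(phi_{k+1})].  If [R_k] is infinite, so is [R_{k+1}].
    Otherwise [R(phi_j)] is finite for [j <= k], which, [N_j / N_{j+1}] being torsion-free
    abelian of finite rank, makes [h |-> h phi_j(h)^-1] injective.  Hence an [h] in [H]
    with [b^-1 h b phi(h)^-1] in [N_{k+1}] lies in [N_{k+1}], and since
    [N_{k+1} / N_{k+2}] is central in [N / N_{k+2}], the classes above that of [b] are those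
    of [b z], where [z] runs through the classes of [phi_{k+1}].

    The group-theoretic input is that every element of [gamma_i(K)] has a power in
    [gamma_i(L)] when [K] is nilpotent and every element of [K] has a power in
    [L gamma_2(K)].  This shows that isolators are subgroups and that
    [H_i] is the intersection of [H] and [N_i].  The reason is that, for [x] in [K] and [y] in
    [gamma_i(K)], the commutator [[x, y]] is a homomorphism in each variable modulo
    [gamma_{i+2}(K)]. *)

Declare Scope grp_scope.
Delimit Scope grp_scope with grp.
Local Infix "*" := gmul : grp_scope.
Local Notation "x ^ n" := (gpow _ x n) : grp_scope.
Local Notation "x '^-1'" := (ginv x) (at level 3, left associativity, format "x '^-1'") : grp_scope.
Local Notation "[~ x , y ]" := (gcomm _ x y) (at level 0) : grp_scope.
Local Notation "P ⊆ Q" := (forall x, P x -> Q x) (at level 70, no associativity) : grp_scope.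
Local Open Scope grp_scope.

(** * Group identities *)

Section Identities.
Variable G : Group.
Implicit Types x y z : G.

Lemma gmulVK x y : x^-1 * (x * y) = y.
Proof. now rewrite gmulA, gmulV, gmul1. Qed.

Lemma gmul_cancel_l x y z : x * y = x * z -> y = z.
Proof. intros e. now rewrite <- (gmulVK x y), e, gmulVK. Qed.

Lemma gmulr1 x : x * gone = x.
Proof. apply (gmul_cancel_l x^-1). now rewrite gmulVK, gmulV. Qed.

Lemma gmulrV x : x * x^-1 = gone.
Proof. apply (gmul_cancel_l x^-1). now rewrite gmulVK, gmulr1. Qed.

Lemma gmulKV x y : x * (x^-1 * y) = y.
Proof. now rewrite gmulA, gmulrV, gmul1. Qed.

Lemma gmul_cancel_r x y z : x * z = y * z -> x = y.
Proof.
intros e. apply (f_equal (fun w => w * z^-1)) in e.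
now rewrite <- !gmulA, gmulrV, !gmulr1 in e.
Qed.

Lemma ginvK x : (x^-1)^-1 = x.
Proof. apply (gmul_cancel_l x^-1). now rewrite gmulrV, gmulV. Qed.

Lemma ginv1 : (gone : G)^-1 = gone.
Proof. apply (gmul_cancel_l gone). now rewrite gmulrV, gmul1. Qed.

Lemma ginvM x y : (x * y)^-1 = y^-1 * x^-1.
Proof.
apply (gmul_cancel_l (x * y)).
now rewrite gmulrV, <- gmulA, gmulKV, gmulrV.
Qed.

Lemma eq_of_gmulV x y : x^-1 * y = gone -> y = x.
Proof. intros e. now rewrite <- (gmulKV x y), e, gmulr1. Qed.

End Identities.

#[local] Hint Rewrite <- gmulA : grp.
#[local] Hint Rewrite gmul1 gmulr1 gmulV gmulrV gmulVK gmulKV ginvK ginv1 ginvM : grp.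

(* The rewrite rules are the complete system for free groups, so every group word
   identity is decided. *)
Ltac grp := unfold gcomm; autorewrite with grp; try easy.

Section Powers.
Variable G : Group.
Implicit Types x y : G.

Lemma gpowD x m n : x ^ (m + n) = x ^ m * x ^ n.
Proof. induction m as [|m IH]; simpl; [grp|]. now rewrite IH, gmulA. Qed.

Lemma gpow1 x : x ^ 1 = x.
Proof. apply gmulr1. Qed.

Lemma gpowSr x n : x ^ (S n) = x ^ n * x.
Proof. now rewrite <- Nat.add_1_r, gpowD, gpow1. Qed.

Lemma gpowM x m n : x ^ (m * n) = (x ^ m) ^ n.
Proof.
induction n as [|n IH].
- now rewrite Nat.mul_0_r.
- now rewrite Nat.mul_succ_r, Nat.add_comm, gpowD, IH.
Qed.

Lemma gpowV x n : (x^-1) ^ n = (x ^ n)^-1.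
Proof.
induction n as [|n IH]; [simpl; grp|].
rewrite (gpowSr x), ginvM. simpl. now rewrite IH.
Qed.

Lemma gpow_conj x y n : (x^-1 * y * x) ^ n = x^-1 * y ^ n * x.
Proof. induction n as [|n IH]; simpl; [grp|]. rewrite IH. grp. Qed.

Lemma gcommV x y : [~ x, y]^-1 = [~ y, x].
Proof. grp. Qed.

End Powers.

(** * Subgroups *)

Definition normal_in {G : Group} (A M : G -> Prop) : Prop :=
  forall x y, A x -> M y -> M (x^-1 * y * x).

Definition mul_set {G : Group} (P R : G -> Prop) : G -> Prop :=
  fun z => exists p r, P p /\ R r /\ z = p * r.

Definition image {G : Group} (f : G -> G) (P : G -> Prop) : G -> Prop :=
  fun z => exists x, P x /\ z = f x.

Section Subgroups.
Variable G : Group.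
Implicit Types P : G -> Prop.

Lemma subgroup1 P : subgroup G P -> P gone.
Proof. now intros [h _]. Qed.

Lemma subgroupM P x y : subgroup G P -> P x -> P y -> P (x * y).
Proof. intros [_ [h _]]. apply h. Qed.

Lemma subgroupV P x : subgroup G P -> P x -> P x^-1.
Proof. intros [_ [_ h]]. apply h. Qed.

Lemma subgroupX P x n : subgroup G P -> P x -> P (x ^ n).
Proof.
intros hP hx.
induction n as [|n IH]; simpl; [now apply subgroup1|now apply subgroupM].
Qed.

Lemma subgroupR P x y : subgroup G P -> P x -> P y -> P [~ x, y].
Proof.
intros hP hx hy. unfold gcomm.
repeat first [apply subgroupM | apply subgroupV | easy].
Qed.

Lemma subgroup_cancel_l P x y : subgroup G P -> P x -> P (x * y) -> P y.
Proof.
intros hP hx hxy. rewrite <- (gmulVK _ x y). apply subgroupM; auto. now apply subgroupV.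
Qed.

Lemma subgroup_cancel_r P x y : subgroup G P -> P y -> P (x * y) -> P x.
Proof.
intros hP hy hxy. replace x with ((x * y) * y^-1) by grp.
apply subgroupM; auto. now apply subgroupV.
Qed.

Lemma setT_subgroup : subgroup G (setT G).
Proof. now repeat split. Qed.

Lemma gen_subgroup (S : G -> Prop) : subgroup G (gen G S).
Proof.
repeat split.
- intros P hP _. now apply subgroup1.
- intros x y hx hy P hP hS. apply subgroupM; auto; [now apply hx|now apply hy].
- intros x hx P hP hS. apply subgroupV; auto. now apply hx.
Qed.

Lemma gen_incl (S : G -> Prop) : S ⊆ gen G S.
Proof. intros x hx P _ hS. auto. Qed.

End Subgroups.

Create HintDb subgroup.
#[local] Hint Resolve setT_subgroup gen_subgroup : subgroup.

Ltac sub_step :=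
  match goal with
  | |- _ => assumption
  | |- setT _ _ => exact I
  | |- subgroup _ _ => solve [eauto with subgroup]
  | |- ?P gone => apply (subgroup1 _ P)
  | |- ?P (gmul _ _) => apply (subgroupM _ P)
  | |- ?P (ginv _) => apply (subgroupV _ P)
  | |- ?P (gpow _ _ _) => apply (subgroupX _ P)
  | |- ?P (gcomm _ _ _) => apply (subgroupR _ P)
  end.

Ltac sub := try solve [ repeat sub_step ].

Section NormalSubgroups.
Variable G : Group.
Implicit Types P R K A M W : G -> Prop.

Lemma mul_set_subgroup P R :
  subgroup G P -> subgroup G R -> normal_in P R -> subgroup G (mul_set P R).
Proof.
intros hP hR hn. split; [|split].
- exists gone, gone. split; [sub|]. split; [sub|]. grp.
- intros _ _ [p [r [hp [hr ->]]]] [p' [r' [hp' [hr' ->]]]].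
  exists (p * p'), ((p'^-1 * r * p') * r'). split; [sub|]. split; [|grp].
  apply subgroupM; auto.
- intros _ [p [r [hp [hr ->]]]].
  exists p^-1, ((p^-1)^-1 * r^-1 * p^-1). split; [sub|]. split; [|grp].
  apply hn; sub.
Qed.

Lemma mul_set_incl_l P R : subgroup G R -> P ⊆ mul_set P R.
Proof. intros hR x hx. exists x, gone. split; [easy|]. split; [sub|grp]. Qed.

Lemma mul_set_incl_r P R : subgroup G P -> R ⊆ mul_set P R.
Proof. intros hP x hx. exists gone, x. split; [sub|]. split; [easy|grp]. Qed.

Lemma normal_in_of_comm A W : subgroup G A -> subgroup G W ->
  (forall x y, A x -> A y -> W [~ x, y]) -> normal_in A (fun x => A x /\ W x).
Proof.
intros hA hW hAW x y hx [hy wy].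
replace (x^-1 * y * x) with (y * [~ y, x]) by grp.
assert (W [~ y, x]) by auto. split; sub.
Qed.

Lemma subgroup_inter P R : subgroup G P -> subgroup G R -> subgroup G (fun x => P x /\ R x).
Proof.
intros hP hR. split; [split; sub|split].
- intros x y [hx rx] [hy ry]. split; sub.
- intros x [hx rx]. split; sub.
Qed.

Lemma gcomm_pow_mem K M x y n : subgroup G K -> subgroup G M -> normal_in K M ->
  K x -> M [~ x, y] -> M [~ x ^ n, y].
Proof.
intros hK hM hn hx hxy. induction n as [|n IH]; simpl.
- replace [~ gone, y] with (gone : G) by grp. sub.
- replace [~ x * x ^ n, y] with (((x ^ n)^-1 * [~ x, y] * x ^ n) * [~ x ^ n, y]) by grp.
  apply subgroupM; auto. apply hn; sub.
Qed.

Lemma gpow_mul_mod K M a b n : subgroup G K -> subgroup G M -> normal_in K M ->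
  K a -> K b -> M [~ a, b] -> M ((a ^ n * b ^ n)^-1 * (a * b) ^ n).
Proof.
intros hK hM hn ha hb hab. induction n as [|n IH]; simpl.
- replace ((gone * gone)^-1 * gone) with (gone : G) by grp. sub.
- replace ((a * a ^ n * (b * b ^ n))^-1 * (a * b * (a * b) ^ n))
    with (((b ^ n)^-1 * [~ a ^ n, b]^-1 * b ^ n) * ((a ^ n * b ^ n)^-1 * (a * b) ^ n)) by grp.
  apply subgroupM; auto. apply hn; sub. apply subgroupV; auto.
  now apply (gcomm_pow_mem K).
Qed.

(* [[x, y]] is the product of the conjugate of [y^-1] by [x] and [y]. *)
Lemma gcomm_pow_r_mod M x y n : subgroup G M -> normal_in (setT G) M ->
  M [~ [~ x, y], y] -> M ([~ x, y ^ n]^-1 * [~ x, y] ^ n).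
Proof.
intros hM hn hxy.
replace [~ x, y ^ n] with ((x^-1 * y^-1 * x) ^ n * y ^ n) by (rewrite gpow_conj, gpowV; grp).
replace ([~ x, y] ^ n) with ((x^-1 * y^-1 * x * y) ^ n) by (f_equal; grp).
apply (gpow_mul_mod (setT G)); sub.
replace [~ x^-1 * y^-1 * x, y] with ((y^-1)^-1 * [~ [~ x, y], y] * y^-1) by grp.
now apply hn.
Qed.

End NormalSubgroups.

(** * Homomorphisms modulo a subgroup *)

Definition hom_mod {G : Group} (B W : G -> Prop) (f : G -> G) : Prop :=
  forall x y, B x -> B y -> W ((f x * f y)^-1 * f (x * y)).

Definition root_closed {G : Group} (A T : G -> Prop) : Prop :=
  forall x n, A x -> 0 < n -> T (x ^ n) -> T x.

Section HomMod.
Context {G : Group} {B W : G -> Prop} {f : G -> G}.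
Hypotheses (B_sub : subgroup G B) (W_sub : subgroup G W) (f_hom : hom_mod B W f).

Lemma hom_mod1 : W (f gone).
Proof.
assert (h : W ((f gone * f gone)^-1 * f (gone * gone))) by (apply f_hom; sub).
rewrite gmul1 in h. rewrite <- (ginvK _ (f gone)). apply subgroupV; auto.
now replace ((f gone)^-1) with ((f gone * f gone)^-1 * f gone) by grp.
Qed.

Lemma hom_mod_mulV x : B x -> W (f x * f x^-1).
Proof.
intros hx.
assert (h : W ((f x * f x^-1)^-1 * f (x * x^-1))) by (apply f_hom; sub).
rewrite gmulrV in h. apply (subgroup_cancel_r _ _ _ (f gone)) in h; auto using hom_mod1.
rewrite <- (ginvK _ (f x * f x^-1)). sub.
Qed.

Lemma hom_mod_preim_subgroup : subgroup G (fun x => B x /\ W (f x)).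
Proof.
split; [|split].
- split; [sub|apply hom_mod1].
- intros x y [hx wx] [hy wy]. split; [sub|].
  apply (subgroup_cancel_l _ _ (f x * f y)^-1); sub. now apply f_hom.
- intros x [hx wx]. split; [sub|].
  apply (subgroup_cancel_l _ _ (f x)); auto. now apply hom_mod_mulV.
Qed.

Lemma hom_modX x n : B x -> W ((f x ^ n)^-1 * f (x ^ n)).
Proof.
intros hx. induction n as [|n IH]; simpl.
- rewrite ginv1, gmul1. apply hom_mod1.
- replace ((f x * f x ^ n)^-1 * f (x * x ^ n))
    with (((f x ^ n)^-1 * f (x ^ n)) * ((f x * f (x ^ n))^-1 * f (x * x ^ n))) by grp.
  apply subgroupM; auto. apply f_hom; sub.
Qed.

Lemma hom_mod_preim_root A x n : root_closed A W ->
  B x -> A (f x) -> 0 < n -> W (f (x ^ n)) -> W (f x).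
Proof.
intros hA hx hfx hn hw. apply (hA _ n hfx hn).
rewrite <- (ginvK _ (f x ^ n)). apply subgroupV; auto.
apply (subgroup_cancel_r _ _ _ (f (x ^ n))); auto. now apply hom_modX.
Qed.

Lemma hom_mod_preim_isolator A P R x : root_closed A W -> A (f x) ->
  (forall p, P p -> B p /\ W (f p)) -> (forall r, R r -> B r /\ W (f r)) ->
  isolator G B (mul_set P R) x -> W (f x).
Proof.
intros hA hfx hP hR [hx [n [hn [p [r [hp [hr e]]]]]]].
apply (hom_mod_preim_root A x n); auto.
rewrite e. apply hom_mod_preim_subgroup; auto.
Qed.

Lemma hom_modR x y : B x -> B y -> W [~ f x, f y] -> W (f [~ x, y]).
Proof.
intros hx hy hxy.
assert (hyx : W ((f y * f x)^-1 * f (y * x))) by now apply f_hom.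
assert (hxy' : W ((f x * f y)^-1 * f (x * y))) by now apply f_hom.
assert (h : W ((f (y * x) * f [~ x, y])^-1 * f (y * x * [~ x, y]))) by (apply f_hom; sub).
replace (y * x * [~ x, y]) with (x * y) in h by grp.
replace (f [~ x, y]) with
  ((((f y * f x)^-1 * f (y * x))^-1 * [~ f x, f y] * ((f x * f y)^-1 * f (x * y)))
   * ((f (y * x) * f [~ x, y])^-1 * f (x * y))^-1) by grp.
sub.
Qed.

Lemma hom_mod_image_subgroup A : (forall x, B x -> A (f x)) -> subgroup G A ->
  normal_in A W -> subgroup G (mul_set (image f B) W).
Proof.
intros hf hA hn. split; [|split].
- exists (f gone), (f gone)^-1. split; [exists gone; split; [sub|easy]|].
  split; [apply subgroupV, hom_mod1; auto|grp].
- intros _ _ [_ [w [[x [hx ->]] [hw ->]]]] [_ [w' [[y [hy ->]] [hw' ->]]]].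
  exists (f (x * y)), (((f x * f y)^-1 * f (x * y))^-1 * ((f y)^-1 * w * f y * w')).
  split; [exists (x * y); split; [sub|easy]|]. split; [|grp].
  apply subgroupM; auto; [apply subgroupV; auto|apply subgroupM; auto].
- intros _ [_ [w [[x [hx ->]] [hw ->]]]].
  exists (f x^-1), (((f x^-1)^-1 * w^-1 * f x^-1) * (f x * f x^-1)^-1).
  split; [exists x^-1; split; [sub|easy]|]. split; [|grp].
  apply subgroupM; auto; [apply hn; [apply hf|]; sub|].
  apply subgroupV; auto. now apply hom_mod_mulV.
Qed.

End HomMod.

Section Homomorphisms.
Context {G : Group} {H : G -> Prop} {f : G -> G}.
Hypotheses (H_sub : subgroup G H) (f_hom : is_hom_on G H f).

Lemma hom1 : f gone = gone.
Proof.
apply (gmul_cancel_l _ (f gone)). rewrite <- f_hom by sub. now rewrite gmul1, gmulr1.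
Qed.

Lemma homV x : H x -> f x^-1 = (f x)^-1.
Proof.
intros hx. apply (gmul_cancel_l _ (f x)). rewrite <- f_hom by sub.
now rewrite !gmulrV, hom1.
Qed.

Lemma homX x n : H x -> f (x ^ n) = f x ^ n.
Proof.
intros hx. induction n as [|n IH]; simpl; [apply hom1|].
now rewrite f_hom, IH by sub.
Qed.

Lemma homR x y : H x -> H y -> f [~ x, y] = [~ f x, f y].
Proof. intros hx hy. unfold gcomm. now rewrite !f_hom, !homV by sub. Qed.

Lemma hom_preim_subgroup P : subgroup G P -> subgroup G (fun x => H x /\ P (f x)).
Proof.
intros hP. apply hom_mod_preim_subgroup; auto.
intros x y hx hy. rewrite f_hom, gmulV by auto. sub.
Qed.

End Homomorphisms.

(** * Isolators *)

Section Isolators.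
Variable G : Group.
Implicit Types A W : G -> Prop.

Lemma isolator_incl A W x : A x -> W x -> isolator G A W x.
Proof. intros hA hW. split; [easy|]. exists 1. rewrite gpow1. auto with arith. Qed.

Lemma isolator_mono A A' W W' :
  A ⊆ A' -> W ⊆ W' -> isolator G A W ⊆ isolator G A' W'.
Proof. intros hA hW x [hx [n [hn h]]]. split; [auto|]. exists n. auto. Qed.

Lemma isolator_root_closed A W : root_closed A (isolator G A W).
Proof.
intros x n hx hn [_ [k [hk h]]]. split; [easy|]. exists (n * k)%nat.
split; [nia|]. now rewrite gpowM.
Qed.

Lemma isolator_subgroup_of_comm A W : subgroup G A -> subgroup G W ->
  (forall x y, A x -> A y -> W [~ x, y]) -> subgroup G (isolator G A W).
Proof.
intros hA hW hAW. split; [|split].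
- apply isolator_incl; sub.
- intros a b [ha [m [hm wa]]] [hb [k [hk wb]]]. split; [sub|].
  exists (m * k)%nat. split; [nia|].
  apply (subgroup_cancel_l _ _ (a ^ (m * k) * b ^ (m * k))^-1); auto.
  + rewrite gpowM, (Nat.mul_comm m k), gpowM. sub.
  + apply (gpow_mul_mod _ A (fun x => A x /\ W x));
      auto using subgroup_inter, normal_in_of_comm. split; [sub|auto].
- intros a [ha [m [hm wa]]]. split; [sub|]. exists m. split; [easy|].
  rewrite gpowV. sub.
Qed.

End Isolators.

(* Pigeonhole on the exponents. *)
Lemma power_mem_of_cosets (G : Group) (P : G -> Prop) (l : list G) x : subgroup G P ->
  (forall n, exists y h, In y l /\ P h /\ x ^ n = y * h) -> exists m, 0 < m /\ P (x ^ m).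
Proof.
intros P_sub cosets.
destruct (choice (fun n y => In y l /\ exists h, P h /\ x ^ n = y * h)) as [f hf].
{ intros n. destruct (cosets n) as [y [h [hy [hh e]]]]. eauto. }
assert (collision : exists i j, i < j /\ f i = f j).
{ apply NNPP. intros distinct.
  assert (f_nodup : NoDup (map f (seq 0 (S (length l))))).
  { apply Injective_map_NoDup; [|apply seq_NoDup]. intros i j e.
    destruct (Nat.lt_trichotomy i j) as [lt|[eq|gt]]; auto;
      exfalso; apply distinct; eauto. }
  apply NoDup_incl_length with (l' := l) in f_nodup.
  - rewrite length_map, length_seq in f_nodup. lia.
  - intros y hy. apply in_map_iff in hy. destruct hy as [n [<- _]]. apply hf. }
destruct collision as [i [j [hij e]]].
exists (j - i). split; [lia|].
destruct (hf i) as [_ [h [hh ei]]], (hf j) as [_ [h' [hh' ej]]].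
replace (x ^ (j - i)) with (h^-1 * h'); [sub|].
apply (gmul_cancel_l _ (x ^ i)). rewrite <- gpowD.
replace (i + (j - i))%nat with j by lia. rewrite ei, ej, e. grp.
Qed.

Lemma finite_index_isolator (G : Group) (H : G -> Prop) : subgroup G H -> finite_index G H ->
  setT G ⊆ isolator G (setT G) H.
Proof.
intros H_sub [l hl] x _. split; [easy|]. now apply (power_mem_of_cosets G H l).
Qed.

(** * Lower central series *)

Section LowerCentralSeries.
Context {G : Group} {K : G -> Prop}.
Hypothesis K_sub : subgroup G K.

Lemma lcs_subgroup n : subgroup G (lcs G K n).
Proof. destruct n; [exact K_sub|apply gen_subgroup]. Qed.
#[local] Hint Resolve lcs_subgroup : subgroup.

Lemma lcs_comm n x y : K x -> lcs G K n y -> lcs G K (S n) [~ x, y].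
Proof. intros hx hy. apply gen_incl. now exists x, y. Qed.

Lemma lcs_succ_min n (P : G -> Prop) : subgroup G P ->
  (forall x y, K x -> lcs G K n y -> P [~ x, y]) -> lcs G K (S n) ⊆ P.
Proof. intros hP h z hz. apply hz; auto. intros ? [x [y [hx [hy ->]]]]. auto. Qed.

Lemma lcs_succ_incl_of_normal n : normal_in K (lcs G K n) -> lcs G K (S n) ⊆ lcs G K n.
Proof.
intros hn. apply lcs_succ_min; [apply lcs_subgroup|]. intros x y hx hy.
replace [~ x, y] with ((x^-1 * y^-1 * x) * y) by grp.
apply subgroupM; sub. apply hn; sub.
Qed.

Lemma lcs_normal n : normal_in K (lcs G K n).
Proof.
induction n as [|n IH]; intros x y hx hy; [simpl in *; sub|].
replace (x^-1 * y * x) with (y * [~ x, y]^-1) by grp.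
assert (lcs G K (S n) [~ x, y]) by now apply lcs_comm, lcs_succ_incl_of_normal.
sub.
Qed.

Lemma lcs_decr m n : m <= n -> lcs G K n ⊆ lcs G K m.
Proof.
induction 1; auto. intros z hz. apply IHle, lcs_succ_incl_of_normal; auto using lcs_normal.
Qed.

Lemma lcs_incl n : lcs G K n ⊆ K.
Proof. apply (lcs_decr 0). lia. Qed.

Lemma lcs_comm_hom_mod_l n y : lcs G K n y ->
  hom_mod K (lcs G K (S (S n))) (fun x => [~ x, y]).
Proof.
intros hy x x' hx hx'. assert (K y) by now apply (lcs_incl n).
replace (([~ x, y] * [~ x', y])^-1 * [~ x * x', y])
  with ([~ x', y]^-1 * [~ x', [~ x, y]]^-1 * [~ x', y]) by grp.
apply lcs_normal; sub. apply subgroupV; sub. now apply lcs_comm, lcs_comm.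
Qed.

Lemma lcs_comm_hom_mod_r n x : K x ->
  hom_mod (lcs G K n) (lcs G K (S (S n))) (fun y => [~ x, y]).
Proof.
intros hx y y' hy hy'. assert (K y) by now apply (lcs_incl n).
assert (K y') by now apply (lcs_incl n).
replace (([~ x, y] * [~ x, y'])^-1 * [~ x, y * y'])
  with ([~ [~ x, y'], [~ x, y]] * [~ y', [~ x, y]]^-1) by grp.
apply subgroupM; sub; [|apply subgroupV; sub]; apply lcs_comm; sub; now apply lcs_comm.
Qed.

(* [x |-> [x, y]] is a homomorphism into an abelian group, hence kills commutators. *)
Lemma lcs_comm_derived n u y : lcs G K 1 u -> lcs G K n y -> lcs G K (S (S n)) [~ u, y].
Proof.
intros hu hy. pose proof (lcs_comm_hom_mod_l n y hy) as hom.
assert (K y) by now apply (lcs_incl n).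
enough (h : K u /\ lcs G K (S (S n)) [~ u, y]) by apply h.
revert u hu. apply lcs_succ_min; [apply hom_mod_preim_subgroup; sub|].
intros a b ha hb. split; [sub|].
apply (hom_modR (B := K) (f := fun x => [~ x, y])); sub.
apply lcs_comm; sub. now apply lcs_comm.
Qed.

Lemma lcs_finitely_generated_mod (g : list G) : (forall x, In x g -> K x) ->
  K ⊆ gen G (fun x => In x g) -> forall n, exists l,
    (forall y, In y l -> lcs G K n y) /\
    lcs G K n ⊆ gen G (fun y => In y l \/ lcs G K (S n) y).
Proof.
intros gK Kg. induction n as [|n [l [hl IH]]].
- exists g. split; [exact gK|]. intros x hx P hP hS. apply (Kg x hx P hP). auto.
- exists (map (fun p => [~ fst p, snd p]) (list_prod g l)). split.
  + intros z hz. apply in_map_iff in hz. destruct hz as [[x y] [<- hz]].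
    apply in_prod_iff in hz. destruct hz as [hx hy]. apply lcs_comm; auto.
  + intros z hz W W_sub W_gen. revert z hz.
    assert (W_lcs : lcs G K (S (S n)) ⊆ W) by auto.
    assert (comm_g : forall x y, In x g -> lcs G K n y -> W [~ x, y]).
    { intros x y hx hy. enough (h : lcs G K n y /\ W [~ x, y]) by apply h.
      apply (IH y hy).
      - apply hom_mod_preim_subgroup; sub.
        intros a b ha hb. now apply W_lcs, lcs_comm_hom_mod_r; auto.
      - intros a [ha|ha]; (split; [auto|]).
        + apply W_gen. left. apply in_map_iff. exists (x, a). split; auto.
          now apply in_prod.
        + now apply (lcs_decr n (S n)); auto.
        + apply W_lcs, lcs_comm; auto. }
    apply lcs_succ_min; auto. intros x y hx hy.
    enough (h : K x /\ W [~ x, y]) by apply h.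
    apply (Kg x hx).
    * apply (hom_mod_preim_subgroup (f := fun x => [~ x, y])); auto.
      intros a b ha hb. now apply W_lcs, lcs_comm_hom_mod_l.
    * auto.
Qed.

End LowerCentralSeries.

#[local] Hint Resolve lcs_subgroup : subgroup.

Lemma lcs_hom {G : Group} {H K : G -> Prop} {f : G -> G} n :
  subgroup G H -> subgroup G K -> is_hom_on G H f -> (forall x, H x -> K (f x)) ->
  forall x, lcs G H n x -> lcs G K n (f x).
Proof.
intros hH hK hf hHK. induction n as [|n IH]; [exact hHK|].
enough (h : lcs G H (S n) ⊆ (fun x => H x /\ lcs G K (S n) (f x)))
  by (intros x hx; apply (h x hx)).
apply lcs_succ_min; [apply hom_preim_subgroup; sub|]. intros x y hx hy.
assert (H y) by now apply (lcs_incl hH n).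
split; [sub|]. rewrite (homR hH hf) by auto. apply lcs_comm; auto.
Qed.

Lemma lcs_mono {G : Group} {L K : G -> Prop} n : subgroup G L -> subgroup G K ->
  L ⊆ K -> lcs G L n ⊆ lcs G K n.
Proof. intros hL hK hLK. now apply (lcs_hom (f := fun x => x)). Qed.

(** * Roots in nilpotent groups *)

Section Roots.
Context {G : Group} {K L : G -> Prop}.
Hypotheses (K_sub : subgroup G K) (L_sub : subgroup G L) (L_incl : L ⊆ K).
Hypothesis K_root : K ⊆ isolator G K (mul_set L (lcs G K 1)).

Let lcs_root_set n := isolator G (lcs G K n) (mul_set (lcs G L n) (lcs G K (S n))).

Local Lemma mul_lcs_subgroup n : subgroup G (mul_set (lcs G L n) (lcs G K (S n))).
Proof.
apply mul_set_subgroup; sub. intros x y hx hy.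
apply (lcs_normal K_sub); auto. now apply L_incl, (lcs_incl L_sub n).
Qed.

Local Lemma lcs_root_set_subgroup n : subgroup G (lcs_root_set n).
Proof.
apply isolator_subgroup_of_comm; auto using mul_lcs_subgroup with subgroup.
intros x y hx hy. apply mul_set_incl_r; sub.
apply lcs_comm; auto. now apply (lcs_incl K_sub n).
Qed.

Local Lemma lcs_root_set_incl_succ n : lcs G K (S n) ⊆ lcs_root_set n.
Proof.
intros z hz. apply isolator_incl; [now apply (lcs_decr K_sub n (S n)); auto|].
apply mul_set_incl_r; sub.
Qed.

Local Lemma lcs_root_set_comm_l n x l :
  K x -> lcs G L n l -> lcs_root_set (S n) [~ x, l].
Proof.
intros hx hl. pose proof (lcs_root_set_subgroup (S n)) as W_sub.
assert (hlK : lcs G K n l) by now apply (lcs_mono (L := L)).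
assert (hom : hom_mod K (lcs_root_set (S n)) (fun x => [~ x, l])).
{ intros a b ha hb. now apply lcs_root_set_incl_succ, lcs_comm_hom_mod_l. }
apply (hom_mod_preim_isolator K_sub W_sub hom (lcs G K (S n)) L (lcs G K 1)); auto.
- apply isolator_root_closed.
- now apply lcs_comm.
- intros p hp. split; [auto|]. apply isolator_incl; [now apply lcs_comm; auto|].
  apply mul_set_incl_l; sub. now apply lcs_comm.
- intros u hu. split; [now apply (lcs_incl K_sub 1)|].
  now apply lcs_root_set_incl_succ, lcs_comm_derived.
Qed.

Lemma lcs_root_succ n :
  lcs G K n ⊆ isolator G (lcs G K n) (mul_set (lcs G L n) (lcs G K (S n))).
Proof.
change (lcs G K n ⊆ lcs_root_set n).
induction n as [|n IH]; [exact K_root|].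
pose proof (lcs_root_set_subgroup (S n)) as W_sub.
apply lcs_succ_min; [exact W_sub|]. intros x y hx hy.
assert (hom : hom_mod (lcs G K n) (lcs_root_set (S n)) (fun y => [~ x, y])).
{ intros a b ha hb. now apply lcs_root_set_incl_succ, lcs_comm_hom_mod_r. }
assert (K_lcs : subgroup G (lcs G K n)) by sub.
apply (hom_mod_preim_isolator K_lcs W_sub hom (lcs G K (S n)) (lcs G L n) (lcs G K (S n)));
  auto.
- apply isolator_root_closed.
- now apply lcs_comm.
- intros l hl. split; [now apply (lcs_mono (L := L))|now apply lcs_root_set_comm_l].
- intros v hv. split; [now apply (lcs_decr K_sub n (S n)); auto|].
  now apply lcs_root_set_incl_succ, lcs_comm.
- now apply IH.
Qed.

Lemma lcs_root n j : n <= j ->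
  lcs G K n ⊆ isolator G K (mul_set (lcs G L n) (lcs G K (S j))).
Proof.
induction 1 as [|j hj IH]; intros y hy.
- apply lcs_root_succ in hy. revert hy. apply isolator_mono; auto.
  now apply lcs_incl.
- destruct (IH y hy) as [hyK [m [hm [l [u [hl [hu e]]]]]]].
  destruct (lcs_root_succ (S j) u hu) as [huj [k [hk [l' [u' [hl' [hu' e']]]]]]].
  assert (K l) by now apply L_incl, (lcs_incl L_sub n).
  assert (K u) by now apply (lcs_incl K_sub (S j)).
  assert (lcs G L n l') by (apply (lcs_decr L_sub n (S j)); auto).
  assert (hlu : lcs G K (S (S j)) ((l ^ k * u ^ k)^-1 * (l * u) ^ k)).
  { apply (gpow_mul_mod G K); sub; [now apply lcs_normal|now apply lcs_comm]. }
  split; [easy|]. exists (m * k)%nat. split; [nia|].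
  exists (l ^ k * l'), (u' * ((l ^ k * u ^ k)^-1 * (l * u) ^ k)).
  split; [sub|]. split; [sub|]. rewrite gpowM, e, e'. grp.
Qed.

Lemma lcs_root_nilpotent c n : trivial_set G (lcs G K c) ->
  lcs G K n ⊆ isolator G K (lcs G L n).
Proof.
intros hc y hy. apply (lcs_root n (n + c)) in hy; [|lia].
destruct hy as [hyK [m [hm [l [u [hl [hu e]]]]]]].
split; [easy|]. exists m. split; [easy|].
assert (hu1 : u = gone) by (apply hc, (lcs_decr K_sub c (S (n + c))); [lia|easy]).
now rewrite e, hu1, gmulr1.
Qed.

End Roots.

(* Apply [lcs_root_nilpotent] in the subgroup generated by the isolator. *)
Lemma isolator_subgroup (G : Group) (P : G -> Prop) c :
  subgroup G P -> trivial_set G (lcs G (setT G) c) -> subgroup G (isolator G (setT G) P).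
Proof.
intros P_sub hc.
set (X := isolator G (setT G) P). set (K := gen G X).
assert (K_sub : subgroup G K) by apply gen_subgroup.
assert (P_X : P ⊆ X) by (intros x hx; now apply isolator_incl).
assert (P_K : P ⊆ K) by (intros x hx; now apply gen_incl, P_X).
enough (h : K ⊆ X).
{ split; [|split].
  - apply P_X. sub.
  - intros x y hx hy. apply h, subgroupM; auto; now apply gen_incl.
  - intros x hx. apply h, subgroupV; auto; now apply gen_incl. }
assert (K_root : K ⊆ isolator G K (mul_set P (lcs G K 1))).
{ intros x hx. apply (hx (isolator G K (mul_set P (lcs G K 1)))).
  - apply isolator_subgroup_of_comm; [easy| |].
    + apply mul_set_subgroup; sub. intros a b ha. apply lcs_normal; auto.
    + intros a b ha hb. apply mul_set_incl_r; sub. now apply lcs_comm.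
  - intros y hy. assert (K y) by now apply gen_incl. destruct hy as [_ [m [hm hy]]].
    split; [easy|]. exists m. split; [easy|]. apply mul_set_incl_l; sub. }
intros x hx.
apply (lcs_root_nilpotent K_sub P_sub P_K K_root c 0) in hx as [_ hx]; [exact (conj I hx)|].
intros z hz. apply hc. revert hz. now apply lcs_mono; sub.
Qed.

(** * Finite rank *)

Lemma gen_cyclic (G : Group) (x z : G) : gen G (eq x) z ->
  exists n, z = x ^ n \/ z = (x ^ n)^-1.
Proof.
intros hz.
enough (h : exists p q, z * x ^ p = x ^ q).
{ destruct h as [p [q e]]. destruct (Nat.le_ge_cases p q) as [hpq|hqp].
  - exists (q - p). left. apply (gmul_cancel_r _ _ _ (x ^ p)).
    rewrite e, <- gpowD. f_equal. lia.
  - exists (p - q). right. apply (gmul_cancel_r _ _ _ (x ^ p)).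
    replace (x ^ p) with (x ^ (p - q) * x ^ q) at 2 by (rewrite <- gpowD; f_equal; lia).
    now rewrite gmulVK. }
apply (hz (fun z => exists p q, z * x ^ p = x ^ q)); [split; [|split]|].
- exists 0, 0. grp.
- intros a b [p [q e]] [p' [q' e']]. exists (p' + p)%nat, (q + q')%nat.
  rewrite !gpowD, <- e, <- gmulA, (gmulA _ b), e', <- !gmulA, <- !gpowD.
  now rewrite Nat.add_comm.
- intros a [p [q e]]. exists q, p. now rewrite <- e, gmulVK.
- intros y <-. exists 0, 1. simpl. grp.
Qed.

(* The isolated subgroups of the abelianization of [A], given as subgroups of [A]. *)
Section Rank.
Variables (G : Group) (A : G -> Prop).
Hypothesis A_sub : subgroup G A.

Definition isolated (T : G -> Prop) : Prop :=
  subgroup G T /\ T ⊆ A /\ (forall x y, A x -> A y -> T [~ x, y]) /\ root_closed A T.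

Definition adjoin (T : G -> Prop) (x : G) : G -> Prop :=
  isolator G A (gen G (fun z => T z \/ z = x)).

Definition adjoin_list (T : G -> Prop) (l : list G) : G -> Prop :=
  fold_right (fun x S => adjoin S x) T l.

Lemma isolated_subgroup T : isolated T -> subgroup G T.
Proof. now intros [h _]. Qed.
#[local] Hint Resolve isolated_subgroup : subgroup.

Lemma isolated_normal T : isolated T -> normal_in A T.
Proof.
intros [hT [TA [TR _]]] x y hx hy. replace (x^-1 * y * x) with (y * [~ y, x]) by grp.
apply subgroupM; auto.
Qed.

Lemma isolator_isolated W : subgroup G W -> (forall x y, A x -> A y -> W [~ x, y]) ->
  isolated (isolator G A W).
Proof.
intros hW hAW. split; [now apply isolator_subgroup_of_comm|].
split; [now intros x [hx _]|]. split; [|apply isolator_root_closed].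
intros x y hx hy. apply isolator_incl; sub. auto.
Qed.

Lemma adjoin_isolated T x : isolated T -> isolated (adjoin T x).
Proof.
intros [_ [_ [TR _]]]. apply isolator_isolated; sub.
intros a b ha hb. apply gen_incl. auto.
Qed.

Lemma adjoin_incl T x : isolated T -> T ⊆ adjoin T x.
Proof.
intros [_ [TA _]] z hz. apply isolator_incl; auto. apply gen_incl. auto.
Qed.

Lemma adjoin_mem T x : A x -> adjoin T x x.
Proof. intros hx. apply isolator_incl; auto. apply gen_incl. auto. Qed.

Lemma adjoin_min T x U : isolated U -> T ⊆ U -> U x -> adjoin T x ⊆ U.
Proof.
intros [U_sub [_ [_ U_root]]] TU hx z [hz [n [hn h]]].
apply (U_root z n hz hn), h; auto. intros y [hy| ->]; auto.
Qed.

Lemma adjoin_exchange T x y : isolated T -> A x -> adjoin T x y -> ~ T y -> adjoin T y x.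
Proof.
intros T_iso hx [hy [m [hm hym]]] not_T.
pose proof T_iso as [T_sub [T_A [_ T_root]]].
assert (hprod : mul_set (gen G (eq x)) T (y ^ m)).
{ apply hym.
  - apply mul_set_subgroup; sub. intros a b ha. apply (isolated_normal T); auto.
    apply ha; auto. now intros _ <-.
  - intros z [hz| ->]; [apply mul_set_incl_r|apply mul_set_incl_l]; sub.
    now apply gen_incl. }
destruct hprod as [z [t [hz [ht e]]]].
destruct (gen_cyclic G x z hz) as [n hn].
assert (hn0 : 0 < n).
{ destruct n; [|lia]. exfalso. apply not_T, (T_root y m hy hm). rewrite e.
  destruct hn as [-> | ->]; simpl; [|rewrite ginv1]; now rewrite gmul1. }
split; [easy|]. exists n. split; [easy|].
set (W := gen G (fun z => T z \/ z = y)).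
assert (W_sub : subgroup G W) by apply gen_subgroup.
assert (W t) by (apply gen_incl; auto). assert (W y) by (apply gen_incl; auto).
assert (hWz : W z) by (replace z with (y ^ m * t^-1) by (rewrite e; grp); sub).
destruct hn as [-> | ->]; [easy|]. rewrite <- (ginvK _ (x ^ n)). sub.
Qed.

Lemma adjoin_list_isolated T l : isolated T -> isolated (adjoin_list T l).
Proof. intros hT. induction l; simpl; auto using adjoin_isolated. Qed.

Lemma adjoin_list_incl T l : isolated T -> T ⊆ adjoin_list T l.
Proof.
intros hT. induction l as [|x l IH]; simpl; auto.
intros z hz. apply adjoin_incl; auto using adjoin_list_isolated.
Qed.

Lemma adjoin_list_mono T U l : T ⊆ U -> adjoin_list T l ⊆ adjoin_list U l.
Proof.
intros TU. induction l as [|x l IH]; simpl; auto.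
intros z [hz [n [hn h]]]. split; [easy|]. exists n. split; [easy|].
apply h; [sub|]. intros y [hy| ->]; apply gen_incl; auto.
Qed.

Lemma adjoin_list_mem T l x : isolated T -> A x -> In x l -> adjoin_list T l x.
Proof.
intros hT hx. induction l as [|y l IH]; simpl; [easy|].
intros [->|hxl]; [now apply adjoin_mem|].
apply adjoin_incl; auto using adjoin_list_isolated.
Qed.

Lemma adjoin_list_drop T U y l : isolated T -> isolated U -> T ⊆ U ->
  (forall x, In x l -> A x) -> U y -> ~ T y -> adjoin_list T l y ->
  exists l', length l = S (length l') /\ incl l' l /\ adjoin_list T l ⊆ adjoin_list U l'.
Proof.
intros T_iso U_iso TU l_A hUy hTy. induction l as [|x l IH]; simpl; intros hy; [easy|].
assert (hx : A x) by (apply l_A; now left).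
assert (l_A' : forall z, In z l -> A z) by (intros; apply l_A; now right).
destruct (classic (adjoin_list T l y)) as [hyl|hyl].
- destruct (IH l_A' hyl) as [l' [len [sub_l' cover]]].
  exists (x :: l'). simpl. split; [lia|]. split.
  + intros z [->|hz]; [now left|right; auto].
  + apply adjoin_min; auto using adjoin_isolated, adjoin_list_isolated, adjoin_mem.
    intros z hz. apply adjoin_incl; auto using adjoin_list_isolated.
- exists l. split; [easy|]. split; [intros z; simpl; auto|].
  apply adjoin_min; auto using adjoin_list_isolated.
  + now apply adjoin_list_mono.
  + apply (adjoin_min (adjoin_list T l) y); auto using adjoin_list_isolated, adjoin_exchange.
    * now apply adjoin_list_mono.
    * now apply adjoin_list_incl.
Qed.

Lemma no_infinite_isolated_chain l (chain : nat -> G -> Prop) :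
  (forall x, In x l -> A x) -> A ⊆ adjoin_list (chain 0) l ->
  (forall i, isolated (chain i)) -> (forall i, chain i ⊆ chain (S i)) ->
  (forall i, exists x, chain (S i) x /\ ~ chain i x) -> False.
Proof.
remember (length l) as n eqn:len. revert l chain len.
induction n as [|n IH]; intros l chain len l_A span iso incr strict;
  destruct (strict 0) as [y [hy1 hy0]];
  destruct (adjoin_list_drop (chain 0) (chain 1) y l) as [l' [len' [l'_l cover]]]; auto;
  try (apply span; now apply (iso 1)); [lia|].
apply (IH l' (fun i => chain (S i))); auto. lia.
Qed.

End Rank.

(* Here [f] stands for the induced homomorphism from [D M / M] to [A / M]: were it not
   injective, the iterated preimages of the trivial subgroup would ascend forever. *)
Section FiniteCorank.
Context {G : Group} {A M D : G -> Prop} {f : G -> G} {l : list G}.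
Hypotheses (A_sub : subgroup G A) (M_isolated : isolated G A M).
Hypotheses (D_sub : subgroup G D) (D_incl : D ⊆ A).
Hypotheses (f_maps : forall x, D x -> A (f x)) (f_hom : hom_mod D M f).
Hypothesis f_M : forall x, D x -> M x -> M (f x).
Hypotheses (l_A : forall x, In x l -> A x) (l_span : A ⊆ adjoin_list G A M l).
Hypothesis f_corank : A ⊆ isolator G A (mul_set (image f D) M).

Fixpoint preimage_chain (i : nat) : G -> Prop :=
  match i with
  | 0 => M
  | S i => isolator G A (mul_set (fun x => D x /\ preimage_chain i (f x)) M)
  end.

Let M_sub : subgroup G M := isolated_subgroup G A M M_isolated.

Local Lemma preimage_chain_isolated i : isolated G A (preimage_chain i) /\ M ⊆ preimage_chain i.
Proof.
induction i as [|i [[chain_sub _] M_chain]]; simpl; [easy|].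
assert (pre_sub : subgroup G (fun x => D x /\ preimage_chain i (f x))).
{ apply hom_mod_preim_subgroup; auto. intros x y hx hy. auto. }
assert (M_pre : M ⊆ mul_set (fun x => D x /\ preimage_chain i (f x)) M)
  by now apply mul_set_incl_r.
split.
- apply isolator_isolated; auto.
  + apply mul_set_subgroup; auto. intros x y [hx _]. apply (isolated_normal G A M); auto.
  + intros x y hx hy. now apply M_pre, M_isolated.
- intros x hx. apply isolator_incl; auto. now apply M_isolated.
Qed.

Local Lemma preimage_chain_preim i x :
  D x -> preimage_chain i (f x) -> preimage_chain (S i) x.
Proof. intros hx hfx. apply isolator_incl; auto. now apply mul_set_incl_l. Qed.

Local Lemma preimage_chain_incr i : preimage_chain i ⊆ preimage_chain (S i).
Proof.
induction i as [|i IH]; [apply (preimage_chain_isolated 1)|].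
intros x. apply isolator_mono; auto. intros y [p [m [[hp hfp] [hm e]]]].
exists p, m. split; [split; [easy|now apply IH]|easy].
Qed.

Local Lemma preimage_chain_reflect i x :
  D x -> preimage_chain (S i) x -> preimage_chain i (f x).
Proof.
intros hx [_ [k [hk [p [m [[hp hfp] [hm e]]]]]]].
destruct (preimage_chain_isolated i) as [[chain_sub [_ [_ chain_root]]] M_chain].
assert (hom : hom_mod D (preimage_chain i) f) by (intros a b ha hb; auto).
assert (hDm : D m).
{ apply (subgroup_cancel_l _ _ p); auto. rewrite <- e. sub. }
apply (hom_mod_preim_root D_sub chain_sub hom A x k chain_root); auto.
rewrite e. apply (hom_mod_preim_subgroup D_sub chain_sub hom); auto.
Qed.

Lemma kernel_trivial_of_finite_corank x : D x -> M (f x) -> M x.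
Proof.
intros hx hfx. apply NNPP. intros hMx.
apply (no_infinite_isolated_chain G A A_sub l preimage_chain);
  auto using preimage_chain_incr.
- intros i. apply preimage_chain_isolated.
- induction i as [|i [y [hy hny]]].
  + exists x. split; [now apply preimage_chain_preim|easy].
  + destruct (preimage_chain_isolated (S i)) as [[chain_sub [chain_A _]] M_chain].
    destruct (preimage_chain_isolated i) as [[chain_sub' [_ [_ chain_root]]] M_chain'].
    assert (hyA : A y) by now apply chain_A.
    destruct (f_corank y hyA) as [_ [m [hm [_ [w [[z [hz ->]] [hw e]]]]]]].
    exists z. split.
    * apply preimage_chain_preim; auto. apply (subgroup_cancel_r _ _ _ w); auto.
      rewrite <- e. sub.
    * intros hz'. apply hny, (chain_root y m hyA hm). rewrite e.
      apply subgroupM; auto. now apply preimage_chain_reflect.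
Qed.

End FiniteCorank.

(** * The isolated lower central series *)

Section IsolatedSeries.
Context {N : Group} {c : nat}.
Hypothesis N_nilpotent : trivial_set N (lcs N (setT N) c).

Lemma Niso_subgroup i : subgroup N (Niso N i).
Proof. apply (isolator_subgroup N _ c); auto with subgroup. apply lcs_subgroup; sub. Qed.

#[local] Hint Resolve Niso_subgroup : subgroup.

Lemma Niso_root x i m : 0 < m -> Niso N i (x ^ m) -> Niso N i x.
Proof. now apply isolator_root_closed. Qed.

Lemma lcs_incl_Niso n : lcs N (setT N) n ⊆ Niso N (S n).
Proof. intros x hx. now apply isolator_incl. Qed.

Lemma Niso_one x : Niso N 1 x.
Proof. now apply lcs_incl_Niso. Qed.

Lemma Niso_decr i j : i <= j -> Niso N j ⊆ Niso N i.
Proof.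
intros hij. apply isolator_mono; [auto|].
apply lcs_decr; sub. lia.
Qed.

Lemma Niso_normal i : normal_in (setT N) (Niso N i).
Proof.
intros x y _ [_ [m [hm h]]]. split; [easy|]. exists m. split; [easy|].
rewrite gpow_conj. apply lcs_normal; sub.
Qed.

(* Descending induction on [j] for [x] in [lcs j]: once [[x, y]] commutes with [y]
   modulo the isolator, [[x, y]^m] is [[x, y^m]]. *)
Lemma Niso_comm i x y : Niso N i y -> Niso N (S i) [~ x, y].
Proof.
destruct i as [|n]; [intros _; apply Niso_one|]. intros [_ [m [hm hym]]].
enough (h : forall d j, j + d = c -> forall x, lcs N (setT N) j x -> Niso N (S (S n)) [~ x, y])
  by now apply (h c 0).
clear x. induction d as [|d IH]; intros j hj x hx.
- replace j with c in hx by lia. rewrite (N_nilpotent x hx).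
  replace [~ gone, y] with (gone : N) by grp. sub.
- assert (hxy : lcs N (setT N) (S j) [~ x, y]).
  { rewrite <- gcommV. apply subgroupV; sub. now apply lcs_comm. }
  apply (Niso_root _ _ m hm).
  apply (subgroup_cancel_l _ _ [~ x, y ^ m]^-1); sub.
  + apply subgroupV; sub. now apply lcs_incl_Niso, lcs_comm.
  + apply gcomm_pow_r_mod; sub; [apply Niso_normal|]. apply (IH (S j)); [lia|easy].
Qed.

Lemma Niso_isolated i : isolated N (Niso N i) (Niso N (S i)).
Proof.
split; [sub|]. split; [apply Niso_decr; auto|]. split.
- intros x y _ hy. now apply Niso_comm.
- intros x m _. apply Niso_root.
Qed.

Lemma Niso_finite_rank i : finitely_generated N -> exists l, (forall x, In x l -> Niso N i x) /\
  Niso N i ⊆ adjoin_list N (Niso N i) (Niso N (S i)) l.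
Proof.
intros [g hg]. pose proof (Niso_isolated i) as iso.
destruct (lcs_finitely_generated_mod (setT_subgroup N) g
  (fun _ _ => I) (fun x _ => hg x) (pred i)) as [l [l_lcs l_gen]].
assert (l_Niso : forall x, In x l -> Niso N i x).
{ intros x hx. now apply isolator_incl; [|apply l_lcs]. }
exists l. split; [exact l_Niso|].
destruct (adjoin_list_isolated N (Niso N i) (Niso_subgroup i) _ l iso)
  as [span_sub [_ [_ root]]].
intros x hx. pose proof hx as [_ [m [hm hxm]]]. apply (root x m hx hm).
apply (l_gen _ hxm); auto. intros y [hy|hy].
- apply adjoin_list_mem; sub; auto.
- apply adjoin_list_incl; sub. apply lcs_incl_Niso. revert hy.
  apply lcs_decr; sub. lia.
Qed.

End IsolatedSeries.

#[local] Hint Resolve Niso_subgroup : subgroup.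

(** * Counting classes *)

Lemma NoDup_list_prod (A B : Type) (l : list A) (l' : list B) :
  NoDup l -> NoDup l' -> NoDup (list_prod l l').
Proof.
intros hl hl'. induction hl as [|x l hx hl IH]; simpl; [constructor|].
apply NoDup_app; auto.
- apply Injective_map_NoDup; auto. now intros y z [= ->].
- intros [a b] hab hab'. apply in_map_iff in hab. destruct hab as [y [[= <- _] _]].
  apply in_prod_iff in hab'. easy.
Qed.

Section Counting.
Variable G : Group.
Implicit Types (D : G -> Prop) (E F r : G -> G -> Prop) (l : list G).

Definition transversal D E l : Prop :=
  NoDup l /\ (forall x, In x l -> D x) /\
  (forall x y, In x l -> In y l -> E x y -> x = y) /\
  (forall a, D a -> exists x, In x l /\ E a x).

Lemma has_n_classesE D E n : Equivalence E ->
  (has_n_classes G D E n <-> exists l, transversal D E l /\ length l = n).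
Proof.
intros E_equiv. split.
- intros [l [len [l_D [sep cover]]]]. exists l. split; [|easy]. repeat split; auto.
  + apply NoDup_nth_error. intros i j hi e.
    destruct (nth_error l i) as [x|] eqn:ei; [|now apply nth_error_Some in ei].
    now apply (sep i j x x ei (eq_sym e)).
  + intros x y hx hy e. apply In_nth_error in hx, hy.
    destruct hx as [i hi], hy as [j hj].
    assert (i = j) by eauto. congruence.
- intros [l [[nodup [l_D [sep cover]]] len]]. exists l. repeat split; auto.
  intros i j x y hi hj e.
  assert (x = y) by eauto using nth_error_In. subst y.
  apply (proj1 (NoDup_nth_error l)); auto; [|congruence].
  apply nth_error_Some. congruence.
Qed.

Lemma equivalence_class_eq E x y : Equivalence E -> (E x = E y <-> E x y).
Proof.
intros E_equiv. split; [intros ->; reflexivity|]. intros e.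
apply functional_extensionality. intros z. apply propositional_extensionality.
now rewrite e.
Qed.

Lemma transversal_length D E l l' : Equivalence E ->
  transversal D E l -> transversal D E l' -> length l <= length l'.
Proof.
intros E_equiv [nodup [l_D [sep _]]] [_ [_ [_ cover']]].
rewrite <- (length_map E l), <- (length_map E l').
apply NoDup_incl_length.
- apply Injective_map_NoDup_in; auto.
  intros x y hx hy e. apply sep; auto. now apply equivalence_class_eq.
- intros P hP. apply in_map_iff in hP. destruct hP as [x [<- hx]].
  destruct (cover' x (l_D x hx)) as [y [hy e]].
  apply in_map_iff. exists y. split; auto. symmetry. now apply equivalence_class_eq.
Qed.

Lemma num_classes_Some D E n : Equivalence E ->
  (num_classes G D E = Some n <-> exists l, transversal D E l /\ length l = n).
Proof.
intros E_equiv. unfold num_classes.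
destruct (excluded_middle_informative _) as [finite|infinite].
- destruct (constructive_indefinite_description _ finite) as [m hm]. simpl.
  apply has_n_classesE in hm as [l [hl len]]; auto. split.
  + intros [= <-]. eauto.
  + intros [l' [hl' len']]. f_equal.
    apply Nat.le_antisymm; subst; eapply transversal_length; eauto.
- split; [easy|]. intros hl. destruct infinite. exists n. now apply has_n_classesE.
Qed.

Lemma num_classes_None D E : Equivalence E ->
  (num_classes G D E = None <-> ~ exists l, transversal D E l).
Proof.
intros E_equiv. destruct (num_classes G D E) as [n|] eqn:e.
- apply num_classes_Some in e as [l [hl _]]; auto. split; [easy|].
  intros hn. destruct hn. eauto.
- split; [|easy]. intros _ [l hl].
  assert (e' : num_classes G D E = Some (length l)) by (apply num_classes_Some; eauto).
  congruence.
Qed.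

Lemma transversal_of_finite_labelling D E r l : Equivalence E ->
  (forall a b x, D a -> D b -> r a x -> r b x -> E a b) ->
  exists l', transversal (fun a => D a /\ exists x, In x l /\ r a x) E l'.
Proof.
intros E_equiv label. induction l as [|x l [l' [nodup [l'_D [sep cover]]]]].
- exists nil. repeat split; try easy; [constructor|]. now intros a [_ [x [[] _]]].
- destruct (classic (exists a, D a /\ r a x /\ forall b, In b l' -> ~ E a b))
    as [[a [ha [hax fresh]]]|stale].
  + exists (a :: l'). split; [|split; [|split]].
    * constructor; auto. intros hal'. now apply (fresh a hal').
    * intros b [<-|hb]; [simpl; eauto|].
      destruct (l'_D b hb) as [hDb [y [hy hby]]]. simpl. eauto.
    * intros b b' [<-|hb] [<-|hb'] e; auto.
      -- now destruct (fresh b' hb').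
      -- symmetry in e. now destruct (fresh b hb).
    * intros b [hb [y [[<-|hy] hby]]]; [exists a; simpl; eauto|].
      destruct (cover b) as [z [hz e]]; [eauto|]. exists z. simpl. auto.
  + exists l'. split; [easy|]. split; [|split; [easy|]].
    * intros b hb. destruct (l'_D b hb) as [hDb [y [hy hby]]]. simpl. eauto.
    * intros a [ha [y [[<-|hy] hay]]]; [|eauto].
      apply NNPP. intros uncovered. apply stale. exists a. repeat split; auto.
      intros b hb e. apply uncovered. eauto.
Qed.

Lemma num_classes_finite D E r l : Equivalence E ->
  (forall a b x, D a -> D b -> r a x -> r b x -> E a b) ->
  (forall a, D a -> exists x, In x l /\ r a x) -> num_classes G D E <> None.
Proof.
intros E_equiv label cover infinite. apply num_classes_None in infinite; auto.
destruct (transversal_of_finite_labelling D E r l E_equiv label)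
  as [l' [nodup [l'_D [sep cover']]]].
apply infinite. exists l'. repeat split; auto. intros x hx. now apply l'_D.
Qed.

Lemma num_classes_finer_None D E F : Equivalence E -> Equivalence F ->
  (forall x y, E x y -> F x y) ->
  num_classes G D F = None -> num_classes G D E = None.
Proof.
intros E_equiv F_equiv E_F F_infinite.
destruct (num_classes G D E) as [n|] eqn:e; auto. exfalso. revert F_infinite.
apply num_classes_Some in e as [l [[_ [_ [_ cover]]] _]]; auto.
apply (num_classes_finite D F E l); auto.
intros a b x _ _ ha hb. transitivity x; [|symmetry]; auto.
Qed.

Section Fibration.
Variables (D D' : G -> Prop) (E E' F : G -> G -> Prop) (t : G -> G -> G).
Hypotheses (E_equiv : Equivalence E) (E'_equiv : Equivalence E') (F_equiv : Equivalence F).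
Hypothesis E_F : forall x y, E x y -> F x y.
Hypothesis t_D : forall b z, D b -> D' z -> D (t b z).
Hypothesis t_F : forall b z, D b -> D' z -> F (t b z) b.
Hypothesis t_surj : forall a b, D a -> D b -> F a b -> exists z, D' z /\ E a (t b z).
Hypothesis t_E : forall b z z', D b -> D' z -> D' z' -> (E (t b z) (t b z') <-> E' z z').

Lemma transversal_fibration l l' : transversal D F l -> transversal D' E' l' ->
  transversal D E (map (fun p => t (fst p) (snd p)) (list_prod l l')).
Proof.
intros [nodup [l_D [sep cover]]] [nodup' [l'_D [sep' cover']]].
assert (sep_prod : forall p q, In p (list_prod l l') -> In q (list_prod l l') ->
  E (t (fst p) (snd p)) (t (fst q) (snd q)) -> p = q).
{ intros [b z] [b' z'] hp hq e. apply in_prod_iff in hp, hq.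
  destruct hp as [hb hz], hq as [hb' hz']. simpl in e.
  assert (hbb' : b = b').
  { apply sep; auto. rewrite <- (t_F b z), <- (t_F b' z') by auto. auto. }
  subst b'. f_equal. apply sep'; auto. apply (t_E b); auto. }
split; [|split; [|split]].
- apply Injective_map_NoDup_in; [|now apply NoDup_list_prod].
  intros p q hp hq e. apply sep_prod; auto. now rewrite e.
- intros x hx. apply in_map_iff in hx. destruct hx as [[b z] [<- hp]].
  apply in_prod_iff in hp. destruct hp. simpl. auto.
- intros x y hx hy e. apply in_map_iff in hx, hy.
  destruct hx as [p [<- hp]], hy as [q [<- hq]]. now rewrite (sep_prod p q).
- intros a ha. destruct (cover a ha) as [b [hb hab]].
  destruct (t_surj a b ha (l_D b hb) hab) as [z [hz haz]].
  destruct (cover' z hz) as [z' [hz' hzz']]. exists (t b z'). split.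
  + apply in_map_iff. exists (b, z'). split; auto. now apply in_prod.
  + rewrite haz. apply t_E; auto.
Qed.

Lemma num_classes_fibration n b0 : D b0 -> num_classes G D F = Some n ->
  num_classes G D E = omul (Some n) (num_classes G D' E').
Proof.
intros hb0 hn. apply num_classes_Some in hn as [l [hl <-]]; auto.
destruct (num_classes G D' E') as [m|] eqn:hm; simpl.
- apply num_classes_Some in hm as [l' [hl' <-]]; auto.
  apply num_classes_Some; auto. eexists. split; [exact (transversal_fibration l l' hl hl')|].
  now rewrite length_map, length_prod.
- destruct (num_classes G D E) as [k|] eqn:hk; auto. exfalso. revert hm.
  apply num_classes_Some in hk as [L [[_ [_ [_ cover]]] _]]; auto.
  apply (num_classes_finite D' E' (fun z x => E (t b0 z) x) L); auto.
  intros z z' x hz hz' e e'. apply (t_E b0); auto. now rewrite e, e'.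
Qed.

End Fibration.

End Counting.

Lemma oprod_Some f k n : oprod f k = Some n -> forall j, j < k -> f (S j) <> None.
Proof.
revert n. induction k as [|k IH]; simpl; intros n e j hj; [lia|].
destruct (oprod f k) as [p|]; [|easy]. destruct (f (S k)) as [r|] eqn:er; [|easy].
destruct (Nat.eq_dec j k) as [->|hne]; [congruence|]. apply (IH p); auto. lia.
Qed.

(** * Twisted conjugacy *)

Section TwistedRelation.
Context {G : Group} {M H L : G -> Prop} {phi : G -> G}.
Hypotheses (M_sub : subgroup G M) (M_normal : normal_in (setT G) M).
Hypotheses (H_sub : subgroup G H) (phi_hom : is_hom_on G H phi).
Hypotheses (L_sub : subgroup G L) (L_incl : L ⊆ H).

Lemma twisted_rel_modE a b : twisted_rel_mod G M L phi a b <->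
  exists g m, L g /\ M m /\ a = g * b * (phi g)^-1 * m.
Proof.
split.
- intros [g [hg hm]]. rewrite (homV H_sub phi_hom) in hm by auto.
  exists g, ((g * b * (phi g)^-1)^-1 * a). split; [easy|]. split; [easy|].
  now rewrite gmulKV.
- intros [g [m [hg [hm ->]]]]. exists g. split; [easy|].
  now rewrite (homV H_sub phi_hom), gmulVK by auto.
Qed.

Lemma twisted_rel_mod_equiv : Equivalence (twisted_rel_mod G M L phi).
Proof.
split.
- intros a. apply twisted_rel_modE. exists gone, gone. split; [sub|]. split; [sub|].
  rewrite (hom1 H_sub phi_hom) by auto. grp.
- intros a b hab. apply twisted_rel_modE in hab as [g [m [hg [hm ->]]]].
  apply twisted_rel_modE. exists g^-1, ((phi g)^-1 * m^-1 * phi g). split; [sub|].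
  split; [apply M_normal; sub|]. rewrite (homV H_sub phi_hom) by auto. grp.
- intros a b d hab hbd. apply twisted_rel_modE in hab as [g [m [hg [hm ->]]]].
  apply twisted_rel_modE in hbd as [g' [m' [hg' [hm' ->]]]].
  apply twisted_rel_modE. exists (g * g'), (((phi g)^-1)^-1 * m' * (phi g)^-1 * m).
  split; [sub|]. split; [apply subgroupM; auto; now apply M_normal|].
  rewrite phi_hom by auto. grp.
Qed.

End TwistedRelation.

Section CentralExtension.
Context {G : Group} {A M H L : G -> Prop} {phi : G -> G}.
Hypotheses (A_sub : subgroup G A) (A_normal : normal_in (setT G) A).
Hypotheses (M_sub : subgroup G M) (M_normal : normal_in (setT G) M) (M_incl : M ⊆ A).
Hypothesis A_central : forall x y, A y -> M [~ x, y].
Hypotheses (H_sub : subgroup G H) (phi_hom : is_hom_on G H phi).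
Hypotheses (L_sub : subgroup G L) (LE : forall x, L x <-> H x /\ A x).
Hypothesis stabilizer_incl : forall b h, H h -> A (b^-1 * h * b * (phi h)^-1) -> A h.

Let L_incl : L ⊆ H := fun x hx => proj1 (proj1 (LE x) hx).
Let twistedE {K : G -> Prop} (K_incl : K ⊆ H) P :=
  twisted_rel_modE (M := P) H_sub phi_hom K_incl.

Lemma twisted_rel_mod_mul_r b z : A z -> twisted_rel_mod G A H phi (b * z) b.
Proof.
intros hz. apply twistedE; auto. exists gone, z.
split; [sub|]. split; [easy|]. rewrite (hom1 H_sub phi_hom). grp.
Qed.

Lemma twisted_rel_mod_lift a b : twisted_rel_mod G A H phi a b ->
  exists z, A z /\ twisted_rel_mod G M H phi a (b * z).
Proof.
intros hab. apply twistedE in hab as [g [m [hg [hm ->]]]]; auto.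
exists ((phi g)^-1 * m * phi g). split; [now apply A_normal|].
apply twistedE; auto. exists g, gone. split; [easy|]. split; [sub|grp].
Qed.

Lemma twisted_rel_mod_fiber b z z' : A z -> A z' ->
  (twisted_rel_mod G M H phi (b * z) (b * z') <-> twisted_rel_mod G M L phi z z').
Proof.
intros hz hz'. rewrite !twistedE by auto.
split; intros [h [m [hh [hm e]]]].
- assert (hA : A h).
  { apply (stabilizer_incl b h hh).
    assert (hzphi : A (((phi h)^-1)^-1 * z'^-1 * (phi h)^-1)) by (apply A_normal; sub).
    assert (A m) by auto.
    replace (b^-1 * h * b * (phi h)^-1)
      with ((b^-1 * (b * z)) * m^-1 * (((phi h)^-1)^-1 * z'^-1 * (phi h)^-1)) by (rewrite e; grp).
    rewrite gmulVK. sub. }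
  exists h, ((z' * (phi h)^-1)^-1 * [~ b, h]^-1 * (z' * (phi h)^-1) * m).
  split; [now apply LE|]. split.
  + apply subgroupM; auto. apply M_normal; [easy|]. apply subgroupV; auto.
  + rewrite <- (gmulVK _ b z), e. grp.
- apply LE in hh as [hh hA].
  exists h, ((z' * (phi h)^-1)^-1 * [~ b, h] * (z' * (phi h)^-1) * m).
  split; [easy|]. split.
  + apply subgroupM; auto. apply M_normal; auto. easy.
  + rewrite e. grp.
Qed.

Lemma num_classes_twisted_extension n :
  num_classes G (setT G) (twisted_rel_mod G A H phi) = Some n ->
  num_classes G (setT G) (twisted_rel_mod G M H phi) =
    omul (Some n) (num_classes G A (twisted_rel_mod G M L phi)).
Proof.
apply (num_classes_fibration G (setT G) A _ _ _ gmul) with (b0 := gone);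
  auto using twisted_rel_mod_mul_r, twisted_rel_mod_lift, twisted_rel_mod_fiber; try easy.
1-3: now apply (twisted_rel_mod_equiv (H := H)).
intros x y [g [hg h]]. exists g. auto.
Qed.

End CentralExtension.

Section Reidemeister.
Variables (N : Group) (c : nat) (H : N -> Prop) (phi : N -> N).
Hypotheses (N_fg : finitely_generated N) (N_tf : torsion_free N).
Hypothesis N_nilpotent : trivial_set N (lcs N (setT N) c).
Hypotheses (H_sub : subgroup N H) (H_index : finite_index N H).
Hypothesis phi_hom : is_hom_on N H phi.

Lemma HisoE i x : Hiso N H i x <-> H x /\ Niso N i x.
Proof.
split.
- intros [hx h]. split; [easy|]. apply (isolator_mono N H _ (gamma N H i)); [easy| |now split].
  apply lcs_mono; sub; easy.
- intros [hx [_ [m [hm h]]]]. split; [easy|].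
  assert (H_root : setT N ⊆ isolator N (setT N) (mul_set H (lcs N (setT N) 1))).
  { intros y hy. apply (isolator_mono N (setT N) (setT N) H); auto.
    - apply mul_set_incl_l; sub.
    - now apply finite_index_isolator. }
  apply (lcs_root_nilpotent (L := H)) with (c := c) in h as [_ [k [hk h]]]; sub; try easy.
  exists (m * k)%nat. split; [nia|]. now rewrite gpowM.
Qed.

Lemma Hiso_subgroup i : subgroup N (Hiso N H i).
Proof.
pose proof (subgroup_inter N H (Niso N i) H_sub (Niso_subgroup N_nilpotent i)) as [h1 [hM hV]].
split; [now apply HisoE|split].
- intros x y hx hy. apply HisoE in hx, hy. now apply HisoE, hM.
- intros x hx. apply HisoE in hx. now apply HisoE, hV.
Qed.
#[local] Hint Resolve Hiso_subgroup : subgroup.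

Lemma Hiso_incl i : Hiso N H i ⊆ H.
Proof. now intros x [hx _]. Qed.

Lemma Hiso_incl_Niso i : Hiso N H i ⊆ Niso N i.
Proof. intros x hx. now apply HisoE. Qed.

Lemma phi_Niso i x : H x -> Niso N i x -> Niso N i (phi x).
Proof.
intros hx hi. destruct (proj2 (HisoE i x) (conj hx hi)) as [_ [m [hm h]]].
split; [easy|]. exists m. split; [easy|].
rewrite <- (homX H_sub phi_hom) by auto. revert h. now apply lcs_hom; sub.
Qed.

Lemma twisted_rel_Niso_equiv i L : subgroup N L -> L ⊆ H ->
  Equivalence (twisted_rel_mod N (Niso N i) L phi).
Proof. apply twisted_rel_mod_equiv; sub. apply Niso_normal. Qed.

Definition displacement (h : N) : N := h * (phi h)^-1.

Lemma displacement_Niso i h : H h -> Niso N i h -> Niso N i (displacement h).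
Proof. intros hh hi. pose proof (phi_Niso i h hh hi). unfold displacement. sub. Qed.

Lemma displacement_Hiso i h : Hiso N H i h -> Niso N i (displacement h).
Proof. intros hh. apply HisoE in hh as [hh hi]. now apply displacement_Niso. Qed.

Lemma displacement_hom_mod i : hom_mod (Hiso N H i) (Niso N (S i)) displacement.
Proof.
intros x y hx hy. unfold displacement at 3. rewrite phi_hom by now apply (Hiso_incl i).
replace ((displacement x * displacement y)^-1 * (x * y * (phi x * phi y)^-1))
  with ([~ (phi x)^-1, displacement y]^-1) by (unfold displacement; grp).
apply subgroupV; sub. now apply (Niso_comm N_nilpotent), displacement_Hiso.
Qed.

(* The classes of [phi_i] are the cosets of the image of the displacement. *)
Lemma displacement_corank i : reidemeister_induced N H phi i <> None ->
  Niso N i ⊆ isolator N (Niso N i)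
    (mul_set (image displacement (Hiso N H i)) (Niso N (S i))).
Proof.
intros finite x hx. split; [easy|].
destruct (reidemeister_induced N H phi i) as [n|] eqn:hn; [|easy].
apply num_classes_Some in hn as [l [[_ [l_A [_ cover]]] _]];
  [|apply twisted_rel_Niso_equiv; [sub|apply Hiso_incl]].
apply (power_mem_of_cosets N _ l).
- apply (hom_mod_image_subgroup (Hiso_subgroup i) (Niso_subgroup N_nilpotent _)
    (displacement_hom_mod i) (Niso N i)); sub; [apply displacement_Hiso|].
  intros y z _. now apply Niso_normal.
- intros k. destruct (cover (x ^ k)) as [y [hy e]]; [sub|].
  apply (twisted_rel_modE H_sub phi_hom (Hiso_incl i)) in e as [g [m [hg [hm ->]]]].
  set (m' := ((phi g)^-1)^-1 * [~ g, y] * (phi g)^-1 * m).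
  exists y, (displacement g * m').
  split; [easy|]. split; [|unfold m', displacement; grp].
  exists (displacement g), m'. split; [now exists g|]. split; [|easy].
  apply subgroupM; sub. apply Niso_normal; [easy|]. apply (Niso_comm N_nilpotent). auto.
Qed.

Lemma displacement_injective_mod i h : reidemeister_induced N H phi i <> None ->
  H h -> Niso N i h -> Niso N (S i) (displacement h) -> Niso N (S i) h.
Proof.
intros finite hH hi. destruct (Niso_finite_rank N_nilpotent i N_fg) as [l [l_A l_span]].
apply (kernel_trivial_of_finite_corank (A := Niso N i) (D := Hiso N H i)
  (f := displacement) (l := l));
  sub; auto using Hiso_incl_Niso, displacement_Hiso, displacement_hom_mod,
    displacement_corank.
- now apply (Niso_isolated N_nilpotent).
- intros x hx. apply displacement_Niso. now apply (Hiso_incl i).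
- now apply HisoE.
Qed.

(* [h phi(h)^-1] is congruent to [b^-1 h b phi(h)^-1] modulo [N_(j+1)] once [h] is in [N_j]. *)
Lemma twisted_stabilizer_incl k b h :
  (forall j, j < k -> reidemeister_induced N H phi (S j) <> None) ->
  H h -> Niso N (S k) (b^-1 * h * b * (phi h)^-1) -> Niso N (S k) h.
Proof.
intros finite hH hb.
enough (descend : forall j, j <= k -> Niso N (S j) h) by now apply descend.
induction j as [|j IH]; intros hj; [apply Niso_one|].
assert (hNj : Niso N (S j) h) by (apply IH; lia).
apply displacement_injective_mod; auto. unfold displacement.
replace (h * (phi h)^-1)
  with (((h^-1)^-1 * [~ b, h] * h^-1) * (b^-1 * h * b * (phi h)^-1)) by grp.
apply subgroupM; sub.
- apply Niso_normal; [easy|]. now apply (Niso_comm N_nilpotent).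
- revert hb. apply Niso_decr. lia.
Qed.

(* Twisted conjugacy modulo [N_(k+1)]: trivial for [k = 0], that of [phi] for [k = c]. *)
Definition twisted_level (k : nat) : N -> N -> Prop := twisted_rel_mod N (Niso N (S k)) H phi.

Lemma twisted_level_equiv k : Equivalence (twisted_level k).
Proof. now apply twisted_rel_Niso_equiv. Qed.

Lemma twisted_level_decr k x y : twisted_level (S k) x y -> twisted_level k x y.
Proof.
intros [g [hg h]]. exists g. split; [easy|]. revert h. apply Niso_decr. auto.
Qed.

Lemma num_twisted_level_zero : num_classes N (setT N) (twisted_level 0) = Some 1.
Proof.
apply num_classes_Some; [apply twisted_level_equiv|]. exists (gone :: nil).
split; [|easy]. split; [repeat constructor; easy|]. repeat split.
- intros x y [<-|[]] [<-|[]]. easy.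
- intros a _. exists gone. split; [now left|]. exists gone. split; [sub|apply Niso_one].
Qed.

Lemma num_twisted_level_succ k n :
  (forall j, j < k -> reidemeister_induced N H phi (S j) <> None) ->
  num_classes N (setT N) (twisted_level k) = Some n ->
  num_classes N (setT N) (twisted_level (S k)) =
    omul (Some n) (reidemeister_induced N H phi (S k)).
Proof.
intros finite. apply num_classes_twisted_extension; sub;
  auto using Niso_normal, HisoE.
- apply Niso_decr. auto.
- intros x y. now apply (Niso_comm N_nilpotent).
- intros b h. now apply twisted_stabilizer_incl.
Qed.

Lemma num_twisted_level k :
  num_classes N (setT N) (twisted_level k) = oprod (reidemeister_induced N H phi) k.
Proof.
induction k as [|k IH]; simpl; [exact num_twisted_level_zero|].
destruct (oprod (reidemeister_induced N H phi) k) as [n|] eqn:e.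
- apply num_twisted_level_succ; auto. now apply (oprod_Some _ k n).
- apply (num_classes_finer_None N _ _ (twisted_level k));
    auto using twisted_level_equiv, twisted_level_decr.
Qed.

Lemma twisted_level_last : twisted_level c = twisted_rel N H phi.
Proof.
apply functional_extensionality. intros a. apply functional_extensionality. intros b.
apply propositional_extensionality.
split; intros [g [hg e]]; exists g; (split; [easy|]).
- destruct e as [_ [m [hm e]]]. apply eq_of_gmulV, (N_tf _ m hm). now apply N_nilpotent.
- rewrite e, gmulV. sub.
Qed.

End Reidemeister.

Theorem mainTheorem4 (N : Group) (c : nat) (H : N -> Prop) (phi : N -> N)
  (Nfg : finitely_generated N) (Ntf : torsion_free N)
  (Ncls : nilpotent_class N c)
  (Hsub : subgroup N H) (Hfi : finite_index N H)
  (Hphi : is_hom_on N H phi) :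
  reidemeister N H phi = oprod (fun i => reidemeister_induced N H phi i) c.
Proof.
destruct Ncls as [N_nilpotent _].
unfold reidemeister. rewrite <- (twisted_level_last N c H phi) by assumption.
now apply (num_twisted_level N c).
Qed.
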